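(* Let $n\geq 2$ and let $K\subset\mathbb{R}^n$ be a convex body with $\mathrm{r}_2(K)>0$. Then \[ \frac{\mathrm{R}_{n-1}(K)}{\mathrm{r}_2(K)}\leq 2\sqrt{2}\sqrt{\frac{n-1}{n}}. \]
   Context: A convex body is a compact convex subset of $\mathbb{R}^n$. For $1\le i\le n$, let $\mathcal{L}^n_i$ be the set of $i$-dimensional linear subspaces of $\mathbb{R}^n$, $K|L$ the orthogonal projection of $K$ onto $L$, $L^\perp$ the orthogonal complement. For a set $C$ contained in an affine subspace $A$, $\mathrm{R}(C;A)$ and $\mathrm{r}(C;A)$ denote the Euclidean circumradius and inradius of $C$ measured within $A$. Define $\mathrm{R}_i(K)=\min_{L\in\mathcal{L}^n_i}\mathrm{R}(K|L;L)$ and $\mathrm{r}_i(K)=\max_{L\in\mathcal{L}^n_i}\max_{x\in L^\perp}\mathrm{r}(K\cap(x+L);x+L)$. *)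

(* Defs.v *)
From HB Require Import structures.
From mathcomp Require Import all_boot all_order all_algebra.
From mathcomp Require Import all_classical all_reals all_analysis.
Set Implicit Arguments. Unset Strict Implicit. Unset Printing Implicit Defensive.
Import Order.TTheory GRing.Theory Num.Theory.
Import numFieldNormedType.Exports.
Local Open Scope classical_set_scope.
Local Open Scope ring_scope.

(* Points of R^n are row vectors 'rV[R]_n; linear subspaces are row spaces
   of square matrices (mxalgebra), with dimension = rank. *)
Section Defs.
Variables (R : realType) (n : nat).
Notation vec := 'rV[R]_n.

Definition dotv (u v : vec) : R := \sum_(i < n) u ord0 i * v ord0 i.
Definition enorm (u : vec) : R := Num.sqrt (dotv u u).

Definition convex_body (K : set vec) : Prop :=
  compact K /\
  (forall x y (t : R), K x -> K y -> 0 <= t -> t <= 1 ->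
     K (t *: x + (1 - t) *: y)).

Definition subspace_dim (i : nat) (L : 'M[R]_n) : Prop := \rank L = i.
Definition inL (L : 'M[R]_n) (v : vec) : Prop := (v <= L)%MS.

Definition in_perp (L : 'M[R]_n) (x : vec) : Prop :=
  forall w, inL L w -> dotv x w = 0.

Definition proj (K : set vec) (L : 'M[R]_n) : set vec :=
  [set p | inL L p /\ exists2 x, K x & in_perp L (x - p)].

Definition affine (x : vec) (L : 'M[R]_n) : set vec :=
  [set y | inL L (y - x)].

Definition cball (c : vec) (r : R) : set vec := [set y | enorm (y - c) <= r].

Definition circumradius (C A : set vec) : R :=
  inf [set r : R | exists2 c, A c & C `<=` cball c r].

Definition inradius (C A : set vec) : R :=
  sup [set r : R | 0 <= r /\ exists2 c, A c & A `&` cball c r `<=` C].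

Definition Rmin (i : nat) (K : set vec) : R :=
  inf [set v : R | exists2 L, subspace_dim i L &
         v = circumradius (proj K L) (affine 0 L)].

Definition rmax (i : nat) (K : set vec) : R :=
  sup [set v : R | exists L, exists x, [/\ subspace_dim i L, in_perp L x &
         v = inradius (K `&` affine x L) (affine x L)]].

End Defs.

(* Main.v *)
Require Import Defs.
From HB Require Import structures.
From mathcomp Require Import all_boot all_order all_algebra.
From mathcomp Require Import all_classical all_reals all_analysis.
From mathcomp Require Import ring lra.
Set Implicit Arguments.
Unset Strict Implicit.
Import Order.TTheory GRing.Theory Num.Theory.
Import numFieldNormedType.Exports.
Local Open Scope classical_set_scope.
Local Open Scope ring_scope.

(** Let [p, q] be a diameter of [K], [u = p - q] and [L] the orthogonal complement
of [u]. For [a, b] in [K], the section of the tetrahedron [p q a b] halfway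
between the edges [pq] and [ab] is a parallelogram with sides [(p - q) / 2] and
[(a - b) / 2]. If [w] is the projection of [a - b] on [L], its height over the
first side is [|w| / 2], and since [|a - b| <= |p - q|] its other height is at
least as large; so it contains a disc of radius [|w| / 4]. Hence [K | L] has
diameter at most [4 r_2(K)], and Jung's theorem in the [(n-1)]-dimensional space
[L] bounds its circumradius by [4 r_2(K) sqrt ((n-1) / (2n))].

Jung's theorem in dimension [m] is obtained from probability measures with
[m + 1] atoms in the set: their variance is at most [d^2 m / (2 (m+1))]. If the
variance is almost maximal, every point [x] of the set is about within the square
root of the maximal variance of the barycentre, since otherwise giving [x] a
small weight and returning to [m + 1] atoms by Caratheodory's argument would
increase the variance too much. *)

(** * Euclidean inner product and norm on row vectors *)

Section DotProduct.
Context {R : realType} {n : nat}.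
Implicit Types (u v w : 'rV[R]_n) (a : R).

Lemma dotvE u v : dotv u v = (u *m v^T) 0 0.
Proof. by rewrite mxE; apply: eq_bigr => i _; rewrite mxE. Qed.

Lemma dotvC u v : dotv u v = dotv v u.
Proof. by apply: eq_bigr => i _; rewrite mulrC. Qed.

Lemma dotvDl u v w : dotv (u + v) w = dotv u w + dotv v w.
Proof. by rewrite !dotvE mulmxDl mxE. Qed.

Lemma dotvZl a u v : dotv (a *: u) v = a * dotv u v.
Proof. by rewrite !dotvE -scalemxAl mxE. Qed.

Lemma dotvDr u v w : dotv w (u + v) = dotv w u + dotv w v.
Proof. by rewrite !(dotvC w) dotvDl. Qed.

Lemma dotvZr a u v : dotv u (a *: v) = a * dotv u v.
Proof. by rewrite !(dotvC u) dotvZl. Qed.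

Lemma dotvNl u v : dotv (- u) v = - dotv u v.
Proof. by rewrite -scaleN1r dotvZl mulN1r. Qed.

Lemma dotvNr u v : dotv u (- v) = - dotv u v.
Proof. by rewrite !(dotvC u) dotvNl. Qed.

Lemma dot0v v : dotv 0 v = 0.
Proof. by rewrite -(scale0r 0) dotvZl mul0r. Qed.

Lemma dotv_suml (I : Type) (r : seq I) (F : I -> 'rV[R]_n) v :
  dotv (\sum_(i <- r) F i) v = \sum_(i <- r) dotv (F i) v.
Proof.
elim: r => [|x r IH]; first by rewrite !big_nil dot0v.
by rewrite !big_cons dotvDl IH.
Qed.

Definition dotv_lin := (dotvDl, dotvDr, dotvZl, dotvZr, dotvNl, dotvNr).

Lemma dotvv_ge0 u : 0 <= dotv u u.
Proof. by apply: sumr_ge0 => i _; rewrite -expr2 sqr_ge0. Qed.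

Lemma dotvv_eq0 u : (dotv u u == 0) = (u == 0).
Proof.
apply/eqP/eqP => [u0|->]; last exact: dot0v.
apply/rowP => i; rewrite mxE.
have sq0 j : true -> 0 <= u ord0 j * u ord0 j by rewrite -expr2 sqr_ge0.
have /eqP : u ord0 i * u ord0 i = 0 by exact: (psumr_eq0P sq0 u0).
by rewrite mulf_eq0 orbb => /eqP.
Qed.

Lemma dotvv_gt0 u : (0 < dotv u u) = (u != 0).
Proof. by rewrite lt_def dotvv_eq0 dotvv_ge0 andbT. Qed.

Lemma enorm_ge0 u : 0 <= enorm u. Proof. exact: sqrtr_ge0. Qed.

Lemma enorm_sqr u : enorm u ^+ 2 = dotv u u.
Proof. by rewrite sqr_sqrtr // dotvv_ge0. Qed.

Lemma enorm_le u a : 0 <= a -> (enorm u <= a) = (dotv u u <= a ^+ 2).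
Proof. by move=> a0; rewrite -enorm_sqr ler_pXn2r // nnegrE ?enorm_ge0. Qed.

Lemma cball_self u a : 0 <= a -> cball u a u.
Proof. by move=> a0; rewrite /cball /= subrr enorm_le // dot0v sqr_ge0. Qed.

End DotProduct.

(** * Jung's theorem *)

Section Jung.
Context {R : realType} {n : nat}.
Implicit Types (x : 'rV[R]_n) (L : 'M[R]_n) (C : set 'rV[R]_n).

Definition weights k (l : 'I_k -> R) := (forall i, 0 <= l i) /\ \sum_i l i = 1.

Definition bary k (l : 'I_k -> R) (p : 'I_k -> 'rV[R]_n) := \sum_i l i *: p i.

Definition moment k (l : 'I_k -> R) (p : 'I_k -> 'rV[R]_n) :=
  \sum_i l i * dotv (p i) (p i).

Definition variance k l p := @moment k l p - dotv (bary l p) (bary l p).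

Lemma bary_inL k L (l : 'I_k -> R) p : (forall i, inL L (p i)) -> inL L (bary l p).
Proof. by move=> pL; apply: summx_sub => i _; apply: scalemx_sub; exact: pL. Qed.

Lemma variance_pairs k (l : 'I_k -> R) p : weights l ->
  variance l p = 2^-1 * \sum_i \sum_j l i * l j * dotv (p i - p j) (p i - p j).
Proof.
move=> [_ l1].
have E i : \sum_j l i * l j * dotv (p i - p j) (p i - p j) =
   l i * dotv (p i) (p i) + l i * moment l p - 2 * dotv (l i *: p i) (bary l p).
  rewrite /moment (dotvC _ (bary _ _)) /bary dotv_suml.
  move Da: (l i * dotv _ _) => a; rewrite !mulr_sumr -[a]mulr1 -[X in a * X]l1 mulr_sumr.
  rewrite -sumrN -!big_split /= -Da.
  by apply: eq_bigr => j _; rewrite !dotv_lin (dotvC (p j) (p i)); ring.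
under eq_bigr do rewrite E.
rewrite !big_split /= sumrN -mulr_suml l1 -mulr_sumr -dotv_suml.
by rewrite /variance -/(moment l p) -/(bary l p); field.
Qed.

(** The squared deviations of the weights from the uniform value have a nonnegative sum. *)
Lemma weights_sqr k (l : 'I_k.+1 -> R) : weights l ->
  k.+1%:R^-1 <= \sum_i l i ^+ 2.
Proof.
move=> [_ l1]; set a := k.+1%:R^-1.
have ka : k.+1%:R * a = 1 by rewrite divff.
have : 0 <= \sum_i (l i - a) ^+ 2 by apply: sumr_ge0 => i _; exact: sqr_ge0.
have -> : \sum_i (l i - a) ^+ 2 = \sum_i l i ^+ 2 - 2 * a * \sum_i l i + a.
  have aE : a = \sum_(i < k.+1) a ^+ 2.
    by rewrite sumr_const card_ord -mulr_natl expr2 mulrA ka mul1r.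
  rewrite [X in _ = _ + X]aE mulr_sumr -sumrN -!big_split /=.
  by apply: eq_bigr => i _; ring.
by rewrite l1; lra.
Qed.

(** In the double sum over pairs the diagonal vanishes, and the off-diagonal weights sum to
    [1 - \sum_i l i ^+ 2], which is at most [k / (k + 1)]. *)
Lemma variance_le k (l : 'I_k.+1 -> R) p d : weights l ->
  (forall i j, dotv (p i - p j) (p i - p j) <= d) ->
  variance l p <= d * (k%:R / (2 * k.+1%:R)).
Proof.
move=> wl pd; have [l0 l1] := wl.
have d0 : 0 <= d by apply: le_trans (pd ord0 ord0); exact: dotvv_ge0.
have E : \sum_i \sum_j l i * l j * dotv (p i - p j) (p i - p j) <=
    d * (1 - \sum_i l i ^+ 2).
  have {1}-> : 1 = \sum_i l i by [].
  rewrite -sumrB mulr_sumr; apply: ler_sum => i _.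
  have -> : l i - l i ^+ 2 = \sum_(j | j != i) l i * l j.
    by rewrite -mulr_sumr -{1}[l i]mulr1 -l1 (bigD1 i) //=; ring.
  rewrite mulr_sumr (bigD1 i) //= subrr dot0v mulr0 add0r.
  apply: ler_sum => j _; rewrite mulrC; apply: ler_wpM2r; last exact: pd.
  exact: mulr_ge0.
rewrite variance_pairs //.
have := weights_sqr wl; set a := _^-1; set s := \sum_i l i ^+ 2 => sa.
have -> : k%:R / (2 * k.+1%:R) = 2^-1 * (1 - a).
  have -> : k%:R = k.+1%:R - 1 :> R by rewrite -natr1 addrK.
  have : k.+1%:R != 0 :> R by rewrite pnatr_eq0.
  by rewrite /a; move: k.+1%:R => q q0; field.
have := ler_wpM2l d0 sa.
set X := \sum_i _ in E *; move: E; rewrite -/s; lra.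
Qed.

(** Appending a column of ones to the points gives [m + 2] rows of rank at most [m + 1], hence a
    nonzero vector in the left kernel. Its sign is free, which settles the sign of the moment. *)
Lemma affine_dependency m L (p : 'I_m.+2 -> 'rV[R]_n) :
  \rank L = m -> (forall i, inL L (p i)) ->
  exists a : 'I_m.+2 -> R, [/\ exists i, a i != 0, \sum_i a i = 0,
    bary a p = 0 & 0 <= moment a p].
Proof.
move=> rL pL; pose P := \matrix_i p i; pose o : 'cV[R]_m.+2 := const_mx 1.
have rk : (\rank (row_mx P o) <= m.+1)%N.
  rewrite -mxrank_tr tr_row_mx -addsmxE.
  apply: (@leq_trans (m + 1)); last by rewrite addn1.
  apply: leq_trans (mxrank_adds_leqif _ _) _; apply: leq_add.
    rewrite mxrank_tr -[leqRHS]rL; apply: mxrankS; apply/row_subP => i.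
    by rewrite rowK; exact: pL.
  exact: rank_leq_row.
have /rowV0Pn [v /sub_kermxP] : kermx (row_mx P o) != 0.
  by rewrite kermx_eq0 -row_leq_rank -ltnNge.
rewrite mul_mx_row => v0 vn0.
have [vP vo] : v *m P = 0 /\ v *m o = 0.
  by apply: eq_row_mx; rewrite v0 row_mx0.
have {}vP : bary (v ord0) p = 0.
  by rewrite -[RHS]vP mulmx_sum_row; apply: eq_bigr => i _; rewrite rowK.
have {}vo : \sum_i v ord0 i = 0.
  move/matrixP/(_ 0 0): vo; rewrite !mxE => vo; rewrite -[RHS]vo.
  by apply: eq_bigr => i _; rewrite mxE mulr1.
have [i vi] : exists i, v ord0 i != 0.
  by have /rV0Pn [i vi] := vn0; exists i.
have [mv|/ltW mv] := leP 0 (moment (v ord0) p).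
  by exists (v ord0); split => //; exists i.
exists (fun i => - v ord0 i); split.
- by exists i; rewrite oppr_eq0.
- by rewrite sumrN vo oppr0.
- by rewrite /bary; under eq_bigr do rewrite scaleNr; rewrite sumrN -/(bary _ _) vP oppr0.
- by rewrite /moment; under eq_bigr do rewrite mulNr; rewrite sumrN oppr_ge0.
Qed.

Lemma drop_zero_weight k (V : zmodType) (F : 'I_k.+1 -> V) j :
  F j = 0 -> \sum_i F i = \sum_(i < k) F (lift j i).
Proof. by move=> Fj; rewrite (bigD1_ord j) //= Fj add0r. Qed.

(* Moving the weights along an affine dependency keeps the barycentre and, with
   the right sign, does not decrease the second moment. *)
Lemma caratheodory_variance m L (p : 'I_m.+2 -> 'rV[R]_n) (l : 'I_m.+2 -> R) :
  \rank L = m -> (forall i, inL L (p i)) -> weights l ->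
  exists (j : 'I_m.+2) (l' : 'I_m.+1 -> R),
    weights l' /\ variance l p <= variance l' (p \o lift j).
Proof.
move=> rL pL [l0 l1].
have [a [[i0 ai0] sa ba ma]] := affine_dependency rL pL.
have [i ai] : exists i, a i < 0.
  apply: contrapT => /forallNP na.
  have a0 i : true -> 0 <= a i by rewrite leNgt => _; apply/negP/na.
  by move/eqP: ai0; apply; exact: (psumr_eq0P a0 sa).
pose F i := l i / - a i.
(* The least ratio [F j] is the largest step along [a] that keeps all weights nonnegative; it
   annihilates the weight of [j]. *)
case: (arg_minP (P := fun i => a i < 0) F ai) => j aj jmin.
pose l' i := l i + F j * a i.
have Fj0 : 0 <= F j by rewrite divr_ge0 // oppr_ge0 ltW.
have l'j : l' j = 0.
  by rewrite /l' /F; field; rewrite lt_eqF.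
exists j, (l' \o lift j).
have sum' : \sum_i l' i = 1 by rewrite big_split /= -mulr_sumr sa mulr0 addr0.
have bary' : bary l' p = bary l p.
  rewrite /bary /l'; under eq_bigr do rewrite scalerDl -scalerA.
  by rewrite big_split /= -scaler_sumr -/(bary a p) ba scaler0 addr0.
have moment' : moment l' p = moment l p + F j * moment a p.
  rewrite /moment mulr_sumr -big_split /=; apply: eq_bigr => k _.
  by rewrite /l'; ring.
split; last first.
  have -> : variance (l' \o lift j) (p \o lift j) = variance l' p.
    have bE : bary (l' \o lift j) (p \o lift j) = bary l' p.
      by apply/esym/drop_zero_weight; rewrite l'j scale0r.
    by rewrite /variance bE; congr (_ - _); apply/esym/drop_zero_weight;
      rewrite l'j mul0r.
  rewrite /variance bary' moment' lerB // lerDl mulr_ge0 //.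
split; last by rewrite -[RHS]sum'; exact/esym/drop_zero_weight.
move=> k /=; rewrite /l'; set i' := lift j k.
have [ak|ak] := leP 0 (a i'); first exact: addr_ge0 (l0 _) (mulr_ge0 Fj0 ak).
have := jmin _ ak; rewrite {2}/F ler_pdivlMr ?oppr_gt0 //; lra.
Qed.

(** The measure is mixed with a point mass at [x], stored at index [ord0]; the variance splits into
    a part within and a part between the two components. *)
Lemma variance_add_point k (l : 'I_k -> R) p x t : weights l -> 0 <= t <= 1 ->
  let q := fun i : 'I_k.+1 => oapp p x (unlift ord0 i) in
  let l' := fun i : 'I_k.+1 => oapp (fun j => (1 - t) * l j) t (unlift ord0 i) in
  weights l' /\ variance l' q =
    (1 - t) * variance l p + t * (1 - t) * dotv (x - bary l p) (x - bary l p).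
Proof.
move=> [l0 l1] /andP[t0 t1] q l'; split.
  split.
    by move=> i; rewrite /l'; case: unliftP => [j|] _ //=; rewrite mulr_ge0 ?subr_ge0.
  rewrite big_ord_recl /l' unlift_none /=.
  by under eq_bigr do rewrite liftK /=; rewrite -mulr_sumr l1; ring.
have bE : bary l' q = t *: x + (1 - t) *: bary l p.
  rewrite /bary big_ord_recl /q /l' unlift_none /= scaler_sumr.
  by congr (_ + _); apply: eq_bigr => i _; rewrite liftK /= scalerA.
have mE : moment l' q = t * dotv x x + (1 - t) * moment l p.
  rewrite /moment big_ord_recl /q /l' unlift_none /= [(1 - t) * \sum_(i < k) _]mulr_sumr.
  by congr (_ + _); apply: eq_bigr => i _; rewrite liftK /= mulrA.
by rewrite /variance bE mE !dotv_lin (dotvC (bary l p) x); ring.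
Qed.

(** Here [d] and [r] are squared lengths. The inequality on [r] is strict because the supremum of
    the variances need not be attained: the centre is the barycentre of a nearly optimal measure. *)
Lemma jung m L C d r : \rank L = m -> C !=set0 -> (forall x, C x -> inL L x) ->
  (forall x y, C x -> C y -> dotv (x - y) (x - y) <= d) ->
  d * (m%:R / (2 * m.+1%:R)) < r ->
  exists2 c, inL L c & forall x, C x -> dotv (x - c) (x - c) <= r.
Proof.
move=> rL [x0 Cx0] CL Cd Br; set B := _ * _ in Br.
pose E := [set v | exists (l : 'I_m.+1 -> R) p,
  [/\ weights l, forall i, C (p i) & v = variance l p]].
have EB v : E v -> v <= B.
  by move=> [l [p [wl pC ->]]]; apply: variance_le => // i j; exact: Cd.
have E0 : E !=set0.
  pose l (i : 'I_m.+1) : R := (i == ord0)%:R.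
  exists (variance l (fun=> x0)), l, (fun=> x0); split => //; split.
    by move=> i; rewrite ler0n.
  by rewrite (bigD1 ord0) //= big1 ?addr0 // => i /negbTE; rewrite /l => ->.
have hE : has_sup E by split => //; exists B => v /EB.
set S := sup E.
have SB : S <= B by apply: ge_sup.
have var0 k (l : 'I_k -> R) p : weights l -> 0 <= variance l p.
  move=> wl; rewrite variance_pairs //; apply: mulr_ge0; rewrite ?invr_ge0 //.
  have [l0 _] := wl.
  by apply: sumr_ge0 => i _; apply: sumr_ge0 => j _; rewrite !mulr_ge0 ?dotvv_ge0.
have S0 : 0 <= S.
  have [v Ev] := E0; apply: le_trans (ub_le_sup hE.2 Ev).
  by have [l [p [wl _ ->]]] := Ev; exact: var0.
pose h := r - B; have h0 : 0 < h by rewrite subr_gt0.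
(* With weight [t] at a far point, the gain [t h] less the tolerance [t h / 2] used below must
   exceed the second-order loss [t^2 (S + h)], which this choice makes equal to [t h / 4]. *)
pose t := h / (4 * (S + h)).
have Sh : 0 < S + h by lra.
have tE : t * (4 * (S + h)) = h by rewrite divfK // gt_eqF //; lra.
have t0 : 0 < t by rewrite divr_gt0 //; lra.
have t1 : t <= 4^-1 by rewrite ler_pdivrMr; lra.
have e0 : 0 < t * h / 2 by rewrite divr_gt0 // mulr_gt0.
have [v [l [p [wl pC ->]]] vS] := sup_adherent e0 hE.
exists (bary l p); first by apply: bary_inL => i; exact: CL (pC i).
move=> x Cx; rewrite leNgt; apply/negP => xr.
have tI : 0 <= t <= 1 by apply/andP; split; lra.
have [wl'] := variance_add_point p x wl tI.
set l' := (fun i => oapp _ t _) in wl' *; set q := (fun i => oapp p x _) => varE.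
have qC i : C (q i) by rewrite /q; case: unliftP => [j|] _; [exact: pC|].
have [j [l2 [wl2 le2]]] := caratheodory_variance rL (fun i => CL _ (qC i)) wl'.
have : variance l2 (q \o lift j) <= S.
  by apply: (ub_le_sup hE.2); exists l2, (q \o lift j); split => // i; exact: qC.
move/(le_trans le2); rewrite varE -/S in vS *.
set V := variance l p in vS *; set X := dotv _ _ in xr *.
move=> le; have XS : S + h <= X by rewrite /h; lra.
have a1 : 0 <= 1 - t by lra.
have b1 : (1 - t) * (S - t * h / 2) <= (1 - t) * V by apply: ler_wpM2l => //; lra.
have b2 : t * (1 - t) * (S + h) <= t * (1 - t) * X by apply: ler_wpM2l => //; rewrite mulr_ge0 // ltW.
(* The terms [S] and [t S] cancel. After division by [t], the left side is at least [3 h / 8] while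
   [t S < h / 4]. *)
have : t * ((1 - t) * h / 2) <= t * (t * S) by nra.
rewrite ler_pM2l // => c1.
have : (1 - t) * h >= 3 / 4 * h by apply: ler_wpM2r; lra.
have : t * h > 0 by exact: mulr_gt0.
lra.
Qed.

End Jung.

(** * Projection along a diameter *)

Section SuccessiveRadii.
Context {R : realType} {n : nat}.
Implicit Types (K : set 'rV[R]_n) (L : 'M[R]_n) (p q a b c u w x : 'rV[R]_n).

Lemma compact_diametral_pair K : compact K -> K !=set0 ->
  exists p q, [/\ K p, K q & forall x y, K x -> K y ->
    dotv (x - y) (x - y) <= dotv (p - q) (p - q)].
Proof.
move=> cK [x0 Kx0].
pose f (z : 'rV[R]_n * 'rV[R]_n) := dotv (z.1 - z.2) (z.1 - z.2).
have cf : continuous f.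
  move=> z; apply: cvg_big => [|i _]; first exact: add_continuous.
  have cc : ((fun z' : 'rV[R]_n * 'rV[R]_n => (z'.1 - z'.2) ord0 i) @ z -->
      (z.1 - z.2) ord0 i).
    rewrite !mxE; under eq_fun do rewrite !mxE.
    by apply: cvgB; [apply: (cvg_comp fst (fun v : 'rV[R]_n => v ord0 i) cvg_fst)
      | apply: (cvg_comp snd (fun v : 'rV[R]_n => v ord0 i) cvg_snd)];
      exact: coord_continuous.
  exact: cvgM.
have KK0 : K `*` K !=set0 by exists (x0, x0).
have [[p q] /set_mem [/= Kp Kq] pq] := compact_EVT_max KK0 (compact_setX cK cK)
  (continuous_subspaceT cf).
by exists p, q; split => // x y Kx Ky; apply: (pq (x, y)); apply/mem_set.
Qed.

(** The point [4^-1 *: (p + q + a + b)] is the centre of the parallelogram, and the last hypothesis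
    puts the displacement in the disc of radius [|w| / 4]. The number [k] measures the component of
    [a - b] along [u]. *)
Lemma convex_body_midsection K p q a b u w k s t :
  convex_body K -> K p -> K q -> K a -> K b ->
  u = p - q -> w = a - b - k *: u -> dotv w u = 0 -> u != 0 -> w != 0 ->
  dotv (a - b) (a - b) <= dotv u u ->
  s ^+ 2 * dotv u u + t ^+ 2 * dotv w w <= dotv w w / 16 ->
  K (4^-1 *: (p + q + a + b) + (s *: u + t *: w)).
Proof.
move=> [_ cK] Kp Kq Ka Kb uE wE wu; rewrite -!dotvv_gt0 => U0 W0.
have abE : a - b = w + k *: u by rewrite wE subrK.
rewrite abE !dotv_lin (dotvC u w) wu => ab st.
set U := dotv u u in U0 ab st *; set W := dotv w w in W0 ab st *.
have sq16 (y : R) : y ^+ 2 <= 16^-1 -> - 4^-1 <= y <= 4^-1.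
  by move=> y2; apply/andP; split; nra.
have /sq16/andP[tl tr] : t ^+ 2 <= 16^-1.
  rewrite -(ler_pM2r W0).
  have : 0 <= s ^+ 2 * U by rewrite mulr_ge0 ?sqr_ge0 // ltW.
  lra.
(* Cauchy-Schwarz: the product in [h2] minus the square in [h1] is [(s - t k)^2 U W], and
   [W + k^2 U <= U] expresses [|a - b| <= |u|]. *)
have /sq16/andP[sl sr] : (s - t * k) ^+ 2 <= 16^-1.
  rewrite -(ler_pM2r (mulr_gt0 U0 W0)).
  have h1 : 0 <= (s * k * U + t * W) ^+ 2 by exact: sqr_ge0.
  have h2 : (s ^+ 2 * U + t ^+ 2 * W) * (W + k ^+ 2 * U) <= W / 16 * U.
    apply: ler_pM => //.
    - by apply: addr_ge0; rewrite mulr_ge0 ?sqr_ge0 // ltW.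
    - by apply: addr_ge0; [exact: ltW|rewrite mulr_ge0 ?sqr_ge0 // ltW].
    - lra.
  lra.
(* The target is the midpoint of a point of [pq] and a point of [ab]. Since [a - b = w + k *: u], a
   shift by [t] along [ab] is compensated by [- t k] along [pq]. *)
have K1 : K ((2^-1 + 2 * (s - t * k)) *: p + (1 - (2^-1 + 2 * (s - t * k))) *: q).
  by apply: cK => //; lra.
have K2 : K ((2^-1 + 2 * t) *: a + (1 - (2^-1 + 2 * t)) *: b).
  by apply: cK => //; lra.
have half0 : 0 <= 2^-1 :> R by lra.
have half1 : 2^-1 <= 1 :> R by lra.
have := cK _ _ _ K1 K2 half0 half1.
congr (K _); apply/rowP => i; rewrite wE uE !mxE; by field.
Qed.

(** A point at distance exactly [r] from the centre, in a direction of [L]. It bounds [r] by the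
    diameter of [K], and gives two distinct points of [K] when [r] is positive. *)
Lemma disc_radius_point K L c x r : L != 0 -> 0 <= r -> affine x L c ->
  affine x L `&` cball c r `<=` K `&` affine x L ->
  exists y, [/\ K c, K y & dotv (y - c) (y - c) = r ^+ 2].
Proof.
move=> /rowV0Pn[e eL e0] r0 cA sub.
have ee : 0 < dotv e e by rewrite dotvv_gt0.
have en : 0 < enorm e by rewrite sqrtr_gt0.
pose v := (r / enorm e) *: e.
have vv : dotv v v = r ^+ 2.
  rewrite !dotv_lin -enorm_sqr; field; exact: lt0r_neq0.
have [Kc _] : (K `&` affine x L) c by apply: sub; split => //; exact: cball_self.
have [Ky _] : (K `&` affine x L) (c + v).
  apply: sub; split.
    rewrite /affine /= addrAC; apply: addmx_sub => //; exact: scalemx_sub.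
  by rewrite /cball /= addrAC subrr add0r enorm_le // vv.
by exists (c + v); split => //; rewrite addrAC subrr add0r.
Qed.

Lemma rank_addsmx_orthogonal u w : u != 0 -> w != 0 -> dotv w u = 0 ->
  \rank (u + w)%MS = 2.
Proof.
move=> u0 w0 wu.
have -> : \rank (u + w)%MS = (\rank u + \rank w)%N.
  apply/mxrank_disjoint_sum/eqP/rowV0P => v; rewrite sub_capmx => /andP[].
  move=> /sub_rVP [s ->] /sub_rVP [t] E.
  have /eqP : s * dotv u u = 0 by rewrite -dotvZl E dotvZl wu mulr0.
  by rewrite mulf_eq0 dotvv_eq0 (negbTE u0) orbF => /eqP ->; rewrite scale0r.
by rewrite !rank_rV u0 w0.
Qed.

(** A [sup] dominates its set only if the set is bounded above. The bound [B] serves for the radii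
    within one plane; for the supremum over planes, [0 < rmax 2 K] excludes the default value
    [0]. *)
Lemma le_rmax2 K c u w r B :
  (forall x y, K x -> K y -> dotv (x - y) (x - y) <= B ^+ 2) -> 0 <= B ->
  0 < rmax 2 K -> u != 0 -> w != 0 -> dotv w u = 0 -> 0 <= r ->
  (forall s t, s ^+ 2 * dotv u u + t ^+ 2 * dotv w w <= r ^+ 2 ->
    K (c + (s *: u + t *: w))) ->
  r <= rmax 2 K.
Proof.
move=> KB B0 rmax0 u0 w0 wu r0 disc.
have uw : dotv u w = 0 by rewrite dotvC.
have U0 : dotv u u != 0 by rewrite dotvv_eq0.
have W0 : dotv w w != 0 by rewrite dotvv_eq0.
pose L := (u + w)%MS.
have rL : \rank L = 2 by exact: rank_addsmx_orthogonal.
have inLP v : inL L v -> exists s t, v = s *: u + t *: w.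
  move=> /sub_addsmxP[[D1 D2]] /= ->.
  exists (D1 0 0), (D2 0 0).
  by rewrite {1}[D1]mx11_scalar {1}[D2]mx11_scalar !mul_scalar_mx.
have spanL s t : inL L (s *: u + t *: w).
  by apply: addmx_sub; apply: scalemx_sub; [exact: addsmxSl|exact: addsmxSr].
(* Planes in [rmax] are indexed by a base point orthogonal to [L], so the projection [z] of [c] on
   [L] is subtracted. *)
pose z := (dotv c u / dotv u u) *: u + (dotv c w / dotv w w) *: w.
pose x := c - z.
have xL : in_perp L x.
  move=> v /inLP[s [t ->]].
  have xu : dotv x u = 0 by rewrite /x /z !dotv_lin wu; field; rewrite U0 W0.
  have xw : dotv x w = 0 by rewrite /x /z !dotv_lin uw; field; rewrite U0 W0.
  by rewrite dotvDr !dotvZr xu xw !mulr0 addr0.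
have cA : affine x L c by rewrite /affine /x /= opprB addrC subrK; exact: spanL.
clearbody x; set E := [set r : R | 0 <= r /\ exists2 c, affine x L c &
  affine x L `&` cball c r `<=` K `&` affine x L].
have Er : E r.
  split => //; exists c => // y [yA yr]; split => //.
  have : inL L (y - c).
    have -> : y - c = (y - x) - (c - x) by rewrite opprB addrA subrK.
    by apply: addmx_sub => //; rewrite eqmx_opp.
  move=> /inLP[s [t E1]].
  have yE : y = c + (s *: u + t *: w) by rewrite -E1 addrC subrK.
  rewrite yE; apply: disc; move: yr; rewrite /cball /= enorm_le // E1.
  by rewrite !dotv_lin wu uw; lra.
have EB : ubound E B.
  move=> r' [r'0 [c' c'A sub]].
  have L0 : L != 0 by rewrite -mxrank_eq0 rL.
  have [y [Kc Ky yr]] := disc_radius_point L0 r'0 c'A sub.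
  by rewrite -(ler_pXn2r (_ : 0 < 2)%N) ?nnegrE // -yr; exact: KB.
have rE : r <= sup E by apply: ub_le_sup => //; exists B.
apply: le_trans rE _; apply: ub_le_sup; last by exists L, x.
by apply: contrapT => nb; move: rmax0; rewrite /rmax sup_out ?ltxx // => -[].
Qed.

(** Since [sup] defaults to [0], positivity yields an actual section and in it a ball of positive
    radius. *)
Lemma rmax_gt0_neq K i : 0 < rmax i.+1 K -> exists x y, [/\ K x, K y & x != y].
Proof.
rewrite /rmax; set S := [set v | _] => r0.
have hS : S !=set0.
  by apply: contrapT => nS; move: r0; rewrite sup_out ?ltxx // => -[].
have [v [L [x [rL _ ->]]] v0] := sup_gt hS r0.
move: v0; rewrite /inradius; set E := [set r | _] => v0.
have hE : E !=set0.
  by apply: contrapT => nS; move: v0; rewrite sup_out ?ltxx // => -[].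
have [r [r0' [c cA sub]] rgt] := sup_gt hE v0.
have L0 : L != 0 by rewrite -mxrank_eq0 rL.
have [y [Kc Ky yr]] := disc_radius_point L0 r0' cA sub.
exists y, c; split => //; rewrite -subr_eq0 -dotvv_gt0 yr.
exact: exprn_gt0.
Qed.

Lemma in_kermx_dotv u x : inL (kermx u^T) x <-> dotv x u = 0.
Proof.
split=> [/sub_kermxP E|E]; first by rewrite dotvE E mxE.
by apply/sub_kermxP/matrixP => i j; rewrite !ord1 -dotvE E mxE.
Qed.

(** The part of [x] orthogonal to [u] lies in the kernel, so it is orthogonal to [x] and to [u],
    hence to itself. *)
Lemma in_perp_kermx u x : u != 0 -> in_perp (kermx u^T) x ->
  exists k, x = k *: u.
Proof.
move=> u0 xp; exists (dotv x u / dotv u u); apply/eqP; rewrite -subr_eq0.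
set w := x - _.
have U0 : dotv u u != 0 by rewrite dotvv_eq0.
have wu : dotv w u = 0 by rewrite !dotv_lin; field.
have xw : dotv x w = 0 by apply/xp/in_kermx_dotv.
by rewrite -dotvv_eq0 {1}/w dotvDl dotvNl dotvZl xw (dotvC u) wu mulr0 subr0.
Qed.

(** * Elementary bounds on circumradii *)

Lemma circumradius_le C A c r : C !=set0 -> 0 <= r -> A c ->
  (forall x, C x -> dotv (x - c) (x - c) <= r ^+ 2) -> circumradius C A <= r.
Proof.
move=> [x0 Cx0] r0 Ac Cr; apply: ge_inf.
  by exists 0 => s [c' _ /(_ _ Cx0)]; apply: le_trans; exact: enorm_ge0.
by exists c => // x Cx; rewrite /cball /= enorm_le //; exact: Cr.
Qed.

Lemma circumradius_ge0 C A : 0 <= circumradius (R := R) (n := n) C A.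
Proof.
rewrite /circumradius; set E := [set r | _].
have [[E0 [b Eb]]|nE] := pselect (has_inf E); last by rewrite inf_out.
apply: lb_le_inf => // s [c Ac Cs].
have [C0|/set0P[x0 Cx0]] := eqVneq C set0; last first.
  by apply: le_trans (Cs _ Cx0); exact: enorm_ge0.
(* For empty [C] every real is an admissible radius at [c], which contradicts the lower bound
   [b]. *)
have /Eb : E (b - 1) by exists c => // x; rewrite C0.
lra.
Qed.

Lemma Rmin_le K i L : \rank L = i ->
  Rmin i K <= circumradius (Defs.proj K L) (affine 0 L).
Proof.
move=> rL; apply: ge_inf; last by exists L.
by exists 0 => _ [L' _ ->]; exact: circumradius_ge0.
Qed.

(** Lifting [x] and [y] along [u] to points [a] and [b] of [K] makes [x - y] the component of
    [a - b] orthogonal to [u], so the midsection holds a disc of radius [|x - y| / 4]. *)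
Lemma proj_diameter_le K p q x y : convex_body K -> 0 < rmax 2 K ->
  K p -> K q -> p != q ->
  (forall a b, K a -> K b -> dotv (a - b) (a - b) <= dotv (p - q) (p - q)) ->
  Defs.proj K (kermx (p - q)^T) x -> Defs.proj K (kermx (p - q)^T) y ->
  enorm (x - y) <= 4 * rmax 2 K.
Proof.
move=> cbK r0 Kp Kq; rewrite -subr_eq0; set u := p - q => u0 pq.
move=> [/in_kermx_dotv xu [a Ka /(in_perp_kermx u0)[k ax]]].
move=> [/in_kermx_dotv yu [b Kb /(in_perp_kermx u0)[l by_]]].
have [->|xy] := eqVneq x y.
  by rewrite subrr enorm_le ?dot0v ?sqr_ge0 // mulr_ge0 // ltW.
set w := x - y; have w0 : w != 0 by rewrite subr_eq0.
have wE : w = a - b - (k - l) *: u.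
  by rewrite scalerBl -ax -by_ /w; apply/rowP => i; rewrite !mxE; ring.
have wu : dotv w u = 0 by rewrite /w dotvDl dotvNl xu yu subr0.
have : enorm w / 4 <= rmax 2 K.
  apply: (le_rmax2 (c := 4^-1 *: (p + q + a + b)) (B := enorm u) _ _ r0 u0 w0 wu).
  - by move=> *; rewrite enorm_sqr; exact: pq.
  - exact: enorm_ge0.
  - by rewrite divr_ge0 // enorm_ge0.
  move=> s t st; apply: (convex_body_midsection cbK Kp Kq Ka Kb erefl wE) => //.
    exact: pq.
  by apply: le_trans st _; rewrite expr_div_n enorm_sqr; lra.
lra.
Qed.

End SuccessiveRadii.

Theorem theorem1p2 (R : realType) (n : nat) (K : set 'rV[R]_n) :
  (2 <= n)%N -> convex_body K -> 0 < rmax 2 K ->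
  Rmin n.-1 K / rmax 2 K <= 2 * Num.sqrt 2 * Num.sqrt (n.-1%:R / n%:R).
Proof.
move=> n2 cbK r0; rewrite ler_pdivrMr //.
have [x0 [y0 [Kx0 Ky0 xy0]]] := rmax_gt0_neq r0.
have [p [q [Kp Kq pq]]] := compact_diametral_pair cbK.1 (ex_intro _ x0 Kx0).
have pNq : p != q.
  have : 0 < dotv (x0 - y0) (x0 - y0) by rewrite dotvv_gt0 subr_eq0.
  by move=> /lt_le_trans/(_ (pq _ _ Kx0 Ky0)); rewrite dotvv_gt0 subr_eq0.
set u := p - q in pq; have u0 : u != 0 by rewrite subr_eq0.
have U0 : dotv u u != 0 by rewrite dotvv_eq0.
set L := kermx u^T.
have rL : \rank L = n.-1 by rewrite mxrank_ker mxrank_tr rank_rV u0 subn1.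
apply: le_trans (Rmin_le K rL) _.
set C := Defs.proj K L; set A := affine 0 L.
have C0 : C !=set0.
  exists (p - (dotv p u / dotv u u) *: u); split.
    by apply/in_kermx_dotv; rewrite dotvDl dotvNl dotvZl; field.
  exists p => // v /in_kermx_dotv vu.
  by rewrite opprB addrC subrK dotvZl (dotvC u v) vu mulr0.
have CL x : C x -> inL L x by case.
set r := rmax 2 K in r0 *.
have Cd x y : C x -> C y -> dotv (x - y) (x - y) <= (4 * r) ^+ 2.
  move=> Cx Cy; rewrite -enorm_le; first exact: proj_diameter_le Cx Cy.
  by rewrite mulr_ge0 // ltW.
set rho := 2 * _ * _ * r.
have rho0 : 0 <= rho by rewrite !mulr_ge0 ?sqrtr_ge0 // ltW.
(* Jung's bound in dimension [n - 1] with squared diameter [16 r^2] equals [8 r^2 (n - 1) / n]. *)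
have rhoE : (4 * r) ^+ 2 * (n.-1%:R / (2 * n.-1.+1%:R)) = rho ^+ 2.
  rewrite /rho !exprMn !sqr_sqrtr ?divr_ge0 // prednK ?(ltnW n2) //.
  by field; rewrite pnatr_eq0 -lt0n ltnW.
rewrite leNgt; apply/negP => lt_rho.
(* Jung's theorem is available only above [rho ^+ 2], so [s] is taken strictly between [rho] and the
   supposedly larger circumradius. *)
set s := (rho + circumradius C A) / 2.
have srho : rho < s by rewrite /s; lra.
have sC : s < circumradius C A by rewrite /s; lra.
have s0 : 0 <= s by lra.
have [|c cL Cc] := jung (r := s ^+ 2) rL C0 CL Cd.
  by rewrite rhoE ltr_pXn2r // ?nnegrE.
have := circumradius_le (A := A) C0 s0 _ Cc.
rewrite leNgt sC => /(_ _)/negP; apply => //.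
by rewrite /A /affine /= subr0.
Qed.
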